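(* Let $K\subseteq\mathbb{R}^d$ be a convex body (not necessarily origin symmetric) and let $\Lambda<\mathbb{R}^d$ be a lattice. Let $\lambda_1\le\cdots\le\lambda_d$ be the successive minima of $K$ with respect to $\Lambda$, and suppose there exists $i\in\{1,\ldots,d\}$ with $\lambda_i\in(1,2]$. Then, setting $k=\max\{j:\lambda_j\le 1\}$ (with $k=0$ if there is no such $j$) and $m=\max\{j:\lambda_j\le 2\}$, we have \[ \#(K\cap\Lambda)\le\frac{3^m}{\lambda_1\cdots\lambda_k}, \] where the empty product (when $k=0$) is equal to $1$.
   Context: A convex body $K\subseteq\mathbb{R}^d$ is a bounded convex set with non-empty interior (not assumed open or closed). A lattice $\Lambda<\mathbb{R}^d$ is a discrete subgroup of $\mathbb{R}^d$ of full rank $d$. The successive minima $\lambda_1\le\cdots\le\lambda_d$ of a convex body $K$ with respect to $\Lambda$ are defined by \[ \lambda_i=\inf\left\{\lambda>0:\dim\mathrm{span}_{\mathbb{R}}\left(\tfrac{\lambda}{2}(K-K)\cap\Lambda\right)\ge i\right\}, \] where $K-K=\{x-y:x,y\in K\}$. The notation $\#X$ denotes the cardinality of a set $X$. *)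

(* Defs.v *)
From HB Require Import structures.
From mathcomp Require Import all_boot all_order all_algebra finmap.
From mathcomp Require Import all_classical all_reals all_analysis.

Set Implicit Arguments.
Unset Strict Implicit.
Unset Printing Implicit Defensive.

Import Order.TTheory GRing.Theory Num.Theory.
Import numFieldNormedType.Exports.

Local Open Scope classical_set_scope.
Local Open Scope ring_scope.

Section LinearSpan.
Variables (F : fieldType) (V : vectType F).
Implicit Types (X : set V) (U W : {vspace V}).

Definition is_lin_span X U :=
  X `<=` [set` U] /\ forall W, X `<=` [set` W] -> (U <= W)%VS.

(* The linear span of a possibly infinite set (MathComp's [span] takes a finite
   sequence): the least subspace containing it, which exists by
   [lin_span_exists]; the default value of [xget] is therefore never used. *)
Definition lin_span X : {vspace V} := xget 0%VS [set U | is_lin_span X U].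

Lemma lin_span_exists X :
  exists s : seq V, [set` s] `<=` X /\ is_lin_span X (span s).
Proof.
pose P n := `[< exists s : seq V, [set` s] `<=` X /\ \dim (span s) = n >].
have P0 : exists n, P n.
  by exists 0%N; apply/asboolP; exists [::]; rewrite span_nil dimv0; split.
have Pb n : P n -> (n <= \dim {:V}%VS)%N.
  by move=> /asboolP[s [_ <-]]; apply: dimvS; apply: subvf.
case: (ex_maxnP P0 Pb) => n /asboolP[s [sX dims]] nmax.
exists s; split=> //; split=> [x Xx|W XW]; last first.
  by apply/span_subvP => x xs; apply: XW; apply: sX.
have dimle : (\dim (span (x :: s)) <= n)%N.
  apply: nmax; apply/asboolP; exists (x :: s); split=> // y.
  by rewrite /= inE => /orP[/eqP->//|ys]; apply: sX.
have sub : (span s <= span (x :: s))%VS by rewrite span_cons addvSr.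
have /eqP eqs : (span s) == (span (x :: s)) by rewrite eqEdim sub dims.
by rewrite /= eqs; apply: memv_span; rewrite inE eqxx.
Qed.

Lemma lin_spanP X : is_lin_span X (lin_span X).
Proof.
have [s [_ sP]] := lin_span_exists X.
by rewrite /lin_span; case: xgetP => [U _ //|/(_ (span s))].
Qed.

Lemma mem_lin_span X v : v \in lin_span X <->
  exists s : seq V, [set` s] `<=` X /\ v \in (span s).
Proof.
split=> [vX|[s [sX vs]]].
  have [s [sX [Xs _]]] := lin_span_exists X; exists s; split=> //.
  by have [_ /(_ _ Xs)/subvP/(_ _ vX)] := lin_spanP X.
apply: (subvP _ _ vs); apply/span_subvP => x xs.
by have [+ _] := lin_spanP X; apply; apply: sX.
Qed.

End LinearSpan.

Section ConvexBodiesAndLattices.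
Variables (R : realType) (d : nat).
Implicit Types (K L A : set 'rV[R]_d).

(* The library's norm on 'rV[R]_d is the sup norm; it has the same bounded sets
   and the same topology as the Euclidean norm. *)
Record is_convex_body K : Prop := IsConvexBody {
  convex_body_convex : convex_set (K : set (convex_lmodType 'rV[R]_d)) ;
  convex_body_bounded : bounded_set K ;
  convex_body_interior : interior K !=set0 }.

Record is_lattice L : Prop := IsLattice {
  lattice_subgroup : zmod_closed [in L] ;
  lattice_discrete : L `<=` isolated L ;
  lattice_full_rank : \dim (lin_span L) = d }.

Definition dilate (t : R) A : set 'rV[R]_d := [set t *: x | x in A].

Definition difference_body K : set 'rV[R]_d := [set x - y | x in K & y in K].

(* Indexed from 1, as usual: meaningful for 1 <= i <= d. *)
Definition succ_min K L (i : nat) : R :=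
  inf [set lam : R | 0 < lam /\
    (i <= \dim (lin_span (dilate (lam / 2) (difference_body K) `&` L)))%N].

End ConvexBodiesAndLattices.

(* Main.v *)
Require Import Defs.
From HB Require Import structures.
From mathcomp Require Import all_boot all_order all_algebra finmap.
From mathcomp Require Import all_classical all_reals all_analysis.
From mathcomp Require Import zify ring lra.

Set Implicit Arguments.
Unset Strict Implicit.
Unset Printing Implicit Defensive.

Import Order.TTheory GRing.Theory Num.Theory.
Import numFieldNormedType.Exports.

Local Open Scope classical_set_scope.
Local Open Scope ring_scope.

(* Let A be a finite subset of K ∩ L. Minkowski's triangular change of variables
   compresses K/2 onto a set S in K/2 that is injective modulo L and has volume
   at least lambda_1 ... lambda_k vol(K/2). The translates a + S, a in A, are then
   disjoint and lie in (3/2)K, whence #A lambda_1 ... lambda_k <= 3^n. Carrying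
   this out in the n-dimensional affine hull of A gives n <= m.

   Volumes are replaced by counts of integer points. In coordinates adapted to
   the flag of the short lattice vectors, with lambda_i approximated by p_i / q
   and G(M) = #(MK ∩ Z^n), the packing gives
     #A p_1 ... p_n G(M) <= G((3q + 1)M)  for all large M;
   iterating it against the trivial bound G(M) <= C M^n yields
     #A p_1 ... p_n <= (3q + 1)^n,  and then q tends to infinity. *)

(** * Dilates of convex sets and difference bodies *)

Section Dilation.
Variables (R : realType) (d : nat).
Implicit Types (K : set 'rV[R]_d) (x y : 'rV[R]_d) (s t : R).

(** Plain real coefficients, instead of the bundled coefficient in [0, 1] of [convex_set], fit the
    weighted sums below. *)
Definition convex K := forall x y s t,
  K x -> K y -> 0 <= s -> 0 <= t -> s + t = 1 -> K (s *: x + t *: y).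

Lemma convex_setE K :
  convex_set (K : set (convex_lmodType 'rV[R]_d)) -> convex K.
Proof.
move=> cK x y s t Kx Ky s0 t0 st.
have s1 : s <= 1 by rewrite -st lerDl.
have -> : t = 1 - s by rewrite -st addrAC subrr add0r.
have := cK x y (Itv01 s0 s1); rewrite !inE; exact.
Qed.

Lemma dilateMl K s t x : dilate t K x -> dilate (s * t) K (s *: x).
Proof. by move=> [z Kz <-]; exists z => //; rewrite scalerA. Qed.

Lemma dilateD K s t x y : convex K -> 0 <= s -> 0 <= t ->
  dilate s K x -> dilate t K y -> dilate (s + t) K (x + y).
Proof.
move=> cK s0 t0 [u Ku <-] [v Kv <-].
have [st0|st_neq0] := eqVneq (s + t) 0.
  have /andP[/eqP-> /eqP->] : (s == 0) && (t == 0) by rewrite -paddr_eq0// st0.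
  by exists u => //; rewrite !(scale0r, addr0).
exists ((s / (s + t)) *: u + (t / (s + t)) *: v).
  by apply: cK => //; rewrite ?divr_ge0 ?addr_ge0// -mulrDl divff.
by rewrite scalerDr !scalerA ![(s + t) * _]mulrC !divfK.
Qed.

Lemma dilate_sum (I : Type) (r : seq I) (w : I -> R) (f : I -> 'rV[R]_d) K :
  K !=set0 -> convex K -> (forall i, 0 <= w i) ->
  (forall i, dilate (w i) K (f i)) ->
  dilate (\sum_(i <- r) w i) K (\sum_(i <- r) f i).
Proof.
move=> [u Ku] cK w0 Kf; elim: r => [|i r IHr].
  by rewrite !big_nil; exists u => //; rewrite scale0r.
by rewrite !big_cons; apply: dilateD => //; apply: sumr_ge0.
Qed.

Lemma dilateS K s t x : convex K -> K 0 -> 0 <= s -> s <= t ->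
  dilate s K x -> dilate t K x.
Proof.
move=> cK K0 s0 st Kx; rewrite -(subrK s t) addrC -[x]addr0.
by apply: dilateD => //; [rewrite subr_ge0|exists 0; rewrite ?scaler0].
Qed.

Lemma dilate_ball K r t x : 0 < t -> (forall y, `|y| <= r -> K y) ->
  `|x| <= t * r -> dilate t K x.
Proof.
move=> t0 Kr xtr; exists (t^-1 *: x); last by rewrite scalerA divff ?gt_eqF// scale1r.
by apply: Kr; rewrite normrZ gtr0_norm ?invr_gt0// ler_pdivrMl.
Qed.

Lemma convex_difference_body K : convex K -> convex (difference_body K).
Proof.
move=> cK _ _ s t [a Ka [b Kb <-]] [a' Ka' [b' Kb' <-]] s0 t0 st.
exists (s *: a + t *: a'); first exact: cK.
exists (s *: b + t *: b'); first exact: cK.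
by rewrite !scalerBr opprD addrACA.
Qed.

Lemma difference_body0 K : K !=set0 -> difference_body K 0.
Proof. by move=> [u Ku]; exists u => //; exists u => //; rewrite subrr. Qed.

Lemma dilate_difference_body K t x y :
  dilate t K x -> dilate t K y -> dilate t (difference_body K) (x - y).
Proof.
move=> [u Ku <-] [v Kv <-]; exists (u - v); last by rewrite scalerBr.
by exists u => //; exists v.
Qed.

End Dilation.

(** * Entrywise bounds for the sup norm *)

Section SupNorm.
Variables (R : realType) (d : nat).
Implicit Types x : 'rV[R]_d.

Lemma ler_entry_norm x i : `|x 0 i| <= `|x|.
Proof. by rewrite [ `|x| ]mx_normrE; apply: (le_bigmax _ _ (0, i)). Qed.

Lemma row_norm_le x r : 0 <= r -> (forall i, `|x 0 i| <= r) -> `|x| <= r.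
Proof.
move=> r0 xr; rewrite [ `|x| ]mx_normrE; apply: bigmax_le => //= -[i j] _ /=.
by rewrite (ord1 i).
Qed.

End SupNorm.

(** * Growth rates of natural numbers *)

Section NatGrowth.
Local Open Scope nat_scope.

Lemma leq_expn2r e a b : a <= b -> a ^ e <= b ^ e.
Proof. by case: e => [|e] ab; rewrite ?expn0// leq_exp2r. Qed.

(** Bernoulli's inequality (1 + 1/b)^k >= 1 + k/b, cleared of denominators. *)
Lemma bernoulli_nat b k : b ^ k * (b + k) <= b.+1 ^ k * b.
Proof.
elim: k => [|k IHk]; first by rewrite addn0.
rewrite !expnS; apply: leq_trans (_ : b.+1 * (b ^ k * (b + k)) <= _).
  rewrite -mulnA mulnCA [b.+1 * _]mulnCA leq_mul2l; apply/orP; right; nia.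
by rewrite -mulnA leq_mul2l IHk orbT.
Qed.

(* Plays the part of the asymptotics [G(M) ~ vol(K) M^n]. *)
Lemma leq_of_exp_bound a b C : 0 < b -> (forall k, a ^ k <= C * b ^ k) -> a <= b.
Proof.
move=> b0 H; rewrite leqNgt; apply/negP => ba.
(* If [a > b], Bernoulli gives b + k <= C b for every [k], which fails at k = b C. *)
have h1 := bernoulli_nat b (b * C).
have h2 : b.+1 ^ (b * C) <= C * b ^ (b * C).
  exact: leq_trans (leq_expn2r _ ba) (H _).
have bk : 0 < b ^ (b * C) by rewrite expn_gt0 b0.
nia.
Qed.

(** The increments of [p] will be the weights of [shear]; monotonicity keeps the truncated
    subtraction exact. *)
Lemma sum_increments (p : nat -> nat) n : p 0 = 0 ->
  (forall i, i < n -> p i <= p i.+1) ->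
  forall k, k <= n -> \sum_(j < k) (p j.+1 - p j) = p k.
Proof.
move=> p0 pS k kn; rewrite -(big_mkord xpredT (fun j => p j.+1 - p j)).
rewrite telescope_sumn_in ?p0 ?subn0// => i ik.
by apply: pS; apply: leq_trans kn.
Qed.

End NatGrowth.

(** * Integer points of dilated bodies *)

Section GridPoints.
Variables (R : realType) (n : nat).
Implicit Types (K : set 'rV[R]_n).

Local Notation "z %:rV" := (map_mx intr z : 'rV[R]_n) (at level 2, format "z %:rV").

Definition int_box (B : nat) : {fset 'rV[int]_n} :=
  [fset \row_i ((f i)%:Z - B%:Z) | f : {ffun 'I_n -> 'I_(2 * B).+1} in predT]%fset.

Lemma card_int_box B : (#|` int_box B| <= (2 * B).+1 ^ n)%N.
Proof.
rewrite card_imfset /=.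
  by rewrite -cardE card_ffun !card_ord.
move=> f g /rowP fg; apply/ffunP => i; apply/val_inj => /=.
by have := fg i; rewrite !mxE; lia.
Qed.

Lemma mem_int_box B (z : 'rV[int]_n) :
  (forall i, `|z 0 i| <= B%:Z) -> z \in int_box B.
Proof.
move=> zB; apply/imfsetP => /=.
exists [ffun i => inord (absz (z 0 i + B%:Z))] => //.
apply/rowP => i; rewrite !mxE ffunE; have := zB i => zi.
by rewrite inordK; lia.
Qed.

(** The box makes the set finite by construction; when [B] bounds [K] it cuts nothing off, and the
    cardinality is G(M). *)
Definition grid K (B M : nat) : {fset 'rV[int]_n} :=
  [fset z in int_box (B * M) | `[< dilate M%:R K z%:rV >]]%fset.

(** The trivial bound C M^n: for M >= 1, 2BM + 1 <= 3(B + 1)M. *)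
Lemma card_grid K B M : (0 < M)%N -> (#|` grid K B M| <= (3 * B.+1 * M) ^ n)%N.
Proof.
move=> M0; apply: leq_trans (fsubset_leq_card (fset_sub _ _)) _.
by apply: leq_trans (card_int_box _) _; apply: leq_expn2r; nia.
Qed.

Lemma mem_grid K B M z : (forall x, K x -> `|x| <= B%:R) ->
  reflect (dilate M%:R K z%:rV) (z \in grid K B M).
Proof.
move=> KB; apply: (iffP idP) => [|Kz].
  by rewrite !inE => /andP[_ /asboolP].
rewrite !inE; apply/andP; split; last exact/asboolP.
apply: mem_int_box => i; case: Kz => x Kx /rowP/(_ i); rewrite !mxE => xz.
rewrite -(ler_int R) intr_norm -xz normrM normr_nat mulrC -pmulrn natrM.
by rewrite ler_wpM2r// (le_trans (ler_entry_norm x i))// KB.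
Qed.

End GridPoints.

(** * The discrete triangular change of variables *)

Section Shear.
Variable n : nat.
Implicit Types (X : {fset 'rV[int]_n}) (p : nat -> nat) (x y : 'rV[int]_n).

(** Equality of [i]-tails is congruence modulo the first [i] coordinate vectors. *)
Definition tail i x : 'rV[int]_n := \row_l (if (i <= l)%N then x 0 l else 0).

Lemma tail_entry i x y (l : 'I_n) : tail i x = tail i y -> (i <= l)%N -> x 0 l = y 0 l.
Proof. by move=> /rowP/(_ l); rewrite !mxE => + il; rewrite il. Qed.

Lemma tailS i j x y : (i <= j)%N -> tail i x = tail i y -> tail j x = tail j y.
Proof.
move=> ij xy; apply/rowP => l; rewrite !mxE; case: ifPn => // jl.
by apply: (tail_entry xy); apply: leq_trans jl.
Qed.

Lemma tail_pred (i : 'I_n) x y :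
  tail i.+1 x = tail i.+1 y -> x 0 i = y 0 i -> tail i x = tail i y.
Proof.
move=> xy xyi; apply/rowP => l; rewrite !mxE; case: ifPn => // il.
have [<-//|/eqP neq_il] := eqVneq i l.
by apply: (tail_entry xy); rewrite ltn_neqAle il andbT; apply/eqP => /val_inj.
Qed.

Lemma tail0 x : tail 0 x = x.
Proof. by apply/rowP => l; rewrite mxE. Qed.

(* For [x \in X], a canonical point of [X] with the same [i]-tail as [x]. *)
Definition rep X i x : 'rV[int]_n :=
  xget 0 [set z | z \in X /\ tail i z = tail i x].

Lemma repP X i x : x \in X -> rep X i x \in X /\ tail i (rep X i x) = tail i x.
Proof.
by move=> xX; apply: (@xgetPex _ 0 [set z | z \in X /\ tail i z = tail i x]); exists x.
Qed.

Lemma eq_rep X i x y : tail i x = tail i y -> rep X i x = rep X i y.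
Proof. by rewrite /rep => ->. Qed.

(* Scales the [i]-th entry by [p i.+1], up to a translation depending on the
   later entries; this is the discrete form of the triangular change of
   variables in the proof of Minkowski's second theorem. *)
Definition shear X p x : 'rV[int]_n :=
  \sum_(i < n) rep X i x *+ (p i.+1 - p i).

(** For [j >= i] the two points share their representative, so those terms cancel. *)
Lemma shearB X p x y i : (i <= n)%N -> tail i x = tail i y ->
  shear X p x - shear X p y =
  \sum_(j < i) (rep X j x - rep X j y) *+ (p j.+1 - p j).
Proof.
move=> le_in xy; rewrite /shear -sumrB.
rewrite (big_ord_widen n (fun j => (rep X j x - rep X j y) *+ (p j.+1 - p j)))//.
rewrite [RHS]big_mkcond; apply: eq_bigr => j _; rewrite -mulrnBl.
case: ltnP => // ij; rewrite (@eq_rep X j x y) ?subrr ?mul0rn//.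
exact: tailS xy.
Qed.

(** In the surviving terms [j <= i] the representatives keep the entry [i], and the weights
    telescope to [p i.+1]. *)
Lemma shearB_entry X p x y (i : 'I_n) : p 0%N = 0%N ->
  (forall j, (j < n)%N -> (p j <= p j.+1)%N) ->
  x \in X -> y \in X -> tail i.+1 x = tail i.+1 y ->
  shear X p x 0 i - shear X p y 0 i = (x 0 i - y 0 i) *+ p i.+1.
Proof.
move=> p0 pS xX yX xy.
have -> : shear X p x 0 i - shear X p y 0 i = (shear X p x - shear X p y) 0 i.
  by rewrite !mxE.
rewrite (shearB X p (ltn_ord i) xy) summxE -(sum_increments p0 pS (ltn_ord i)).
rewrite -sumrMnr; apply: eq_bigr => j _; rewrite mulmxnE !mxE.
have ji : (j <= i)%N by rewrite -ltnS.
have [_ /tail_entry->//] := repP j xX; have [_ /tail_entry->//] := repP j yX.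
Qed.

End Shear.

(** * The packing inequality and its iteration *)

Section Packing.
Variables (R : realType) (n : nat) (K : set 'rV[R]_n) (r : R) (B : nat).
Hypothesis cK : convex K.
Hypothesis Kr : forall x : 'rV[R]_n, `|x| <= r -> K x.
Hypothesis r0 : 0 < r.
Hypothesis KB : forall x, K x -> `|x| <= B%:R.
Variables (A : {fset 'rV[R]_n}) (p : nat -> nat) (q : nat).
Hypothesis AK : forall a, a \in A -> K a.
Hypothesis q0 : (0 < q)%N.
Hypothesis p0 : p 0%N = 0%N.
Hypothesis pS : forall i, (i < n)%N -> (p i <= p i.+1)%N.
Hypothesis pq : (p n <= q)%N.
(** Here [p i.+1 / q] stands for the minimum lambda_(i+1): a short difference of points of [A] lies
    in the span of the first [i] coordinate vectors. The successor on [p i.+1] leaves room for the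
    rounding in [code]. *)
Hypothesis Ap : forall a a' (i : 'I_n), a \in A -> a' \in A ->
  dilate ((p i.+1).+1%:R / (2 * q)%:R) (difference_body K) (a' - a) ->
  forall j : 'I_n, (i <= j)%N -> a 0 j = a' 0 j.

Local Notation "z %:rV" := (map_mx intr z : 'rV[R]_n) (at level 2, format "z %:rV").

Let K0 : K 0. Proof. by apply: Kr; rewrite normr0 ltW. Qed.
Let KK : K !=set0. Proof. by exists 0. Qed.

Lemma p_le_q (i : 'I_n) : (p i.+1 <= q)%N.
Proof.
apply: leq_trans pq; rewrite -(sum_increments p0 pS (leqnn n)).
rewrite -(sum_increments p0 pS (ltn_ord i)).
rewrite (big_ord_widen n (fun j => p j.+1 - p j)%N)// [leqLHS]big_mkcond.
by apply: leq_sum => j _; case: ifP.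
Qed.

(** By convexity a weighted sum of points of M K lies in M K scaled by the total weight, here
    [p n]. *)
Lemma shear_dilate M x : x \in grid K B M ->
  dilate (p n * M)%:R K (shear (grid K B M) p x)%:rV.
Proof.
move=> xX; rewrite /shear -(sum_increments p0 pS (leqnn n)) natrM natr_sum.
rewrite raddf_sum mulr_suml; apply: dilate_sum => // j.
rewrite raddfMn /= -[X in dilate _ _ X]scaler_nat; apply: dilateMl.
by apply/(mem_grid _ _ KB); case: (repP j xX).
Qed.

(** Only the weights with index at most [i] survive in the difference, hence the smaller factor
    [p i.+1]. *)
Lemma shearB_dilate M x y (i : 'I_n) : x \in grid K B M -> y \in grid K B M ->
  tail i.+1 x = tail i.+1 y ->
  dilate (p i.+1 * M)%:R (difference_body K)
    (shear (grid K B M) p x - shear (grid K B M) p y)%:rV.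
Proof.
move=> xX yX xy; rewrite (shearB _ _ (ltn_ord i) xy).
rewrite -(sum_increments p0 pS (ltn_ord i)) natrM natr_sum.
rewrite raddf_sum mulr_suml; apply: dilate_sum => [|||j].
- by exists 0; apply: difference_body0.
- exact: convex_difference_body.
- by move=> j; apply: mulr_ge0; rewrite ler0n.
rewrite raddfMn raddfB /= -[X in dilate _ _ X]scaler_nat; apply: dilateMl.
apply: dilate_difference_body.
  by apply/(mem_grid _ _ KB); case: (repP j xX).
by apply/(mem_grid _ _ KB); case: (repP j yX).
Qed.

(* The points [2 M q a + shear x], each thickened to a box of [\prod_i p i.+1]
   integer points, are pairwise distinct in [(3 q + 1) M K]; rounding [2 M q a]
   costs a bounded error, absorbed by the [+ 1]. *)
Definition code M (u : A * grid K B M * {dffun forall i : 'I_n, 'I_(p i.+1)}) :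
    'rV[int]_n :=
  \row_i (Num.floor ((2 * M * q)%:R * val u.1.1 0 i)
    + shear (grid K B M) p (val u.1.2) 0 i + (u.2 i)%:Z).

(** The factor (3q + 1)M is spent as 2qM on [a], qM on the shear, and M on rounding and offset. *)
Lemma code_mem M u : q.+1%:R <= M%:R * r ->
  @code M u \in grid K B ((3 * q).+1 * M).
Proof.
case: M u => [|M] u qM; first by move: qM; rewrite mul0r leNgt ltr0n.
apply/(mem_grid _ _ KB).
set a := val u.1.1; set x := val u.1.2.
have Ka : K a by apply: AK; apply: valP.
have Sx := shear_dilate (valP u.1.2); rewrite -/x in Sx.
set y := shear _ _ _ in Sx.
(* Each entry of [e] is a floor error in (-1, 0] plus an offset in [0, q - 1]. *)
pose e := (@code M.+1 u)%:rV - ((2 * M.+1 * q)%:R *: a + y%:rV).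
have -> : (@code M.+1 u)%:rV = (2 * M.+1 * q)%:R *: a + y%:rV + e.
  by rewrite /e addrC subrK.
have -> : ((3 * q).+1 * M.+1)%:R = (2 * M.+1 * q)%:R + (q * M.+1)%:R + M.+1%:R :> R.
  by rewrite -!natrD; congr (_%:R); lia.
apply: dilateD => //; first apply: dilateD => //; first by exists a.
  apply: dilateS Sx => //.
  by rewrite ler_nat leq_mul2r pq orbT.
apply: (dilate_ball _ Kr); first by rewrite ltr0n.
apply: le_trans qM; apply: row_norm_le => // i.
have := p_le_q i; have bp := ltn_ord (u.2 i) => pi.
rewrite !mxE -/a -/x -/y /= !rmorphD /=.
set t := _ * a 0 i.
have tl := ge_floor t; have tu := lt_succ_floor t.
have b1 : (u.2 i)%:~R + 1 <= q%:R :> R.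
  by rewrite -pmulrn natr1 ler_nat (leq_trans bp).
have b2 : 0 <= (u.2 i)%:~R :> R by rewrite ler0z.
move: tu; rewrite intrD -[q.+1]addn1 natrD ler_norml => tu.
apply/andP; split; lra.
Qed.

(** Decodes the entry [i] once the later entries of the grid point are known: first [a] by
    separation, then grid point and offset by uniqueness of division by [p i.+1]. *)
Lemma code_step M u v (i : 'I_n) : q.+1%:R <= M%:R * r ->
  @code M u = @code M v -> tail i.+1 (val u.1.2) = tail i.+1 (val v.1.2) ->
  [/\ val u.1.1 0 i = val v.1.1 0 i, tail i (val u.1.2) = tail i (val v.1.2)
    & u.2 i = v.2 i].
Proof.
case: M u v => [|M] u v qM; first by move: qM; rewrite mul0r leNgt ltr0n.
move=> /rowP uv xx'.
set a := val u.1.1; set a' := val v.1.1.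
set x := val u.1.2 in xx' *; set x' := val v.1.2 in xx' *.
have xX : x \in grid K B M.+1 by apply: valP.
have x'X : x' \in grid K B M.+1 by apply: valP.
pose N : R := (2 * M.+1 * q)%:R.
have N0 : 0 < N by rewrite ltr0n !muln_gt0 q0.
have aa' : a 0 i = a' 0 i.
  (* As the codes agree, N (a' - a) equals y - y' up to an error of norm at most q + 1, which the
     inscribed ball absorbs. *)
  apply: (Ap (i := i)) => //; [exact: valP|exact: valP|].
  set y := shear (grid K B M.+1) p x; set y' := shear (grid K B M.+1) p x'.
  have yy' := shearB_dilate xX x'X xx'; rewrite -/y -/y' in yy'.
  have -> : a' - a = N^-1 *: ((y - y')%:rV + (N *: (a' - a) - (y - y')%:rV)).
    by rewrite [_ + (N *: _ - _)]addrC subrK scalerA mulVf ?gt_eqF// scale1r.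
  have -> : (p i.+1).+1%:R / (2 * q)%:R =
      N^-1 * ((p i.+1 * M.+1)%:R + M.+1%:R) :> R.
    rewrite -[(p i.+1).+1]addn1 /N !natrM !natrD; field.
    by rewrite nat1r !pnatr_eq0 -lt0n q0.
  apply: dilateMl; apply: dilateD yy' _ => //; first exact: convex_difference_body.
  apply: (dilate_ball (r := r)) => //.
    by move=> z zr; exists z; [exact: Kr|exists 0; rewrite ?subr0].
  apply: le_trans qM; apply: row_norm_le => // l.
  have /(congr1 (intr : int -> R)) := uv l.
  rewrite !mxE -/a -/a' -/x -/x' -/y -/y' -/N !rmorphD /= mulrBr.
  have pl := p_le_q l; have bl := ltn_ord (u.2 l); have b'l := ltn_ord (v.2 l).
  have b1 : (u.2 l)%:~R <= q%:R :> R by rewrite -pmulrn ler_nat ltnW// (leq_trans bl).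
  have b1' : (v.2 l)%:~R <= q%:R :> R by rewrite -pmulrn ler_nat ltnW// (leq_trans b'l).
  have b2 : 0 <= (u.2 l)%:~R :> R by rewrite ler0z.
  have b2' : 0 <= (v.2 l)%:~R :> R by rewrite ler0z.
  set t := _ * a 0 l; set t' := _ * a' 0 l.
  have tl := ge_floor t; have tu := lt_succ_floor t.
  have tl' := ge_floor t'; have tu' := lt_succ_floor t'.
  move: tu tu'; rewrite !intrD -[q.+1]addn1 natrD ler_norml => tu tu' E.
  by rewrite rmorphN /=; apply/andP; split; lra.
have := uv i; rewrite !mxE -/a -/a' -/x -/x' aa' => E.
have := shearB_entry p0 pS xX x'X xx'.
have bi := ltn_ord (u.2 i); have b'i := ltn_ord (v.2 i) => D.
have D' : (x 0 i - x' 0 i) * (p i.+1)%:Z = (v.2 i)%:Z - (u.2 i)%:Z.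
  by move: D; rewrite -mulr_natr natz => <-; lia.
(* Both offsets are below [p i.+1], so a multiple of [p i.+1] equal to their difference is zero. *)
have xi : x 0 i = x' 0 i by nia.
split=> //; first exact: tail_pred.
by apply/val_inj => /=; move: D'; rewrite xi subrr mul0r; lia.
Qed.

(** Decoding runs from the last entry to the first, starting from the [n]-tails, which are zero. *)
Lemma code_inj M : q.+1%:R <= M%:R * r -> injective (@code M).
Proof.
move=> qM u v uv.
have H k : (k <= n)%N -> tail (n - k) (val u.1.2) = tail (n - k) (val v.1.2).
  elim: k => [_|k IHk kn].
    by apply/rowP => l; rewrite !mxE subn0 leqNgt ltn_ord.
  have ik : (n - k.+1 < n)%N by lia.
  have [] := @code_step M u v (Ordinal ik) qM uv; last by [].

  by rewrite /= subnSK// IHk// ltnW.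
have {}H i : tail i (val u.1.2) = tail i (val v.1.2).
  by have := H n (leqnn n); rewrite subnn; apply: tailS.
have S (i : 'I_n) := code_step qM uv (H i.+1).
have eb : u.2 = v.2 by apply/ffunP => i; case: (S i).
have ea : u.1.1 = v.1.1 by apply/val_inj/rowP => i; case: (S i).
have ex : u.1.2 = v.1.2 by apply/val_inj; rewrite -(tail0 (val u.1.2)) H tail0.
by case: u v eb ea ex {uv H S} => [[a x] b] [[a' x'] b'] /= -> -> ->.
Qed.

Lemma grid_growth M : q.+1%:R <= M%:R * r ->
  (#|` A| * \prod_(i < n) p i.+1 * #|` grid K B M| <=
    #|` grid K B ((3 * q).+1 * M)|)%N.
Proof.
move=> qM; rewrite mulnAC !cardfE.
have -> : (\prod_(i < n) p i.+1)%N = #|{dffun forall i : 'I_n, 'I_(p i.+1)}|.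
  rewrite card_dep_ffun foldrE big_map big_enum /=.
  by apply: eq_bigr => i _; rewrite card_ord.
rewrite -!card_prod.
pose f u : grid K B ((3 * q).+1 * M) := [` code_mem u qM]%fset.
by apply: (leq_card f) => u v /(congr1 val); apply: code_inj.
Qed.

(** With c = 3q + 1, [k] rounds of [grid_growth] give a^k G(M0) <= G(c^k M0) <= C (c^n)^k; comparing
    growth in [k] leaves a <= c^n. *)
Lemma card_separated_le : (#|` A| * \prod_(i < n) p i.+1 <= (3 * q).+1 ^ n)%N.
Proof.
(* From this scale on, the rounding error q + 1 fits into M times the inscribed ball. *)
pose M0 := Num.bound (q.+1%:R / r).
have M0q M : (M0 <= M)%N -> q.+1%:R <= M%:R * r.
  move=> M0M; rewrite -ler_pdivrMr//; apply: le_trans (ltW (archi_boundP _)) _.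
    by rewrite divr_ge0 ?ler0n// ltW.
  by rewrite ler_nat.
have M00 : (0 < M0)%N.
  by rewrite -(ltr_nat R); apply: le_lt_trans (archi_boundP _); rewrite divr_ge0 ?ler0n// ltW.
set a := (_ * _)%N; set c := (3 * q).+1.
apply: (@leq_of_exp_bound a (c ^ n) ((3 * B.+1 * M0) ^ n)).
  by rewrite expn_gt0.
move=> k.
have G0 : (0 < #|` grid K B M0|)%N.
  rewrite cardfs_gt0; apply/fset0Pn; exists 0; apply/(mem_grid _ _ KB).
  by exists 0 => //; rewrite scaler0 map_mx0.
have : (a ^ k * #|` grid K B M0| <= #|` grid K B (c ^ k * M0)|)%N.
  elim: k => [|k IHk]; first by rewrite !mul1n.
  rewrite !expnS -[(a * _ * _)%N]mulnA -[(c * _ * _)%N]mulnA; apply: leq_trans (grid_growth _).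
    by rewrite -/a leq_mul2l IHk orbT.
  by apply: M0q; rewrite leq_pmull// expn_gt0.
move=> /leq_trans/(_ (card_grid _ _ _)); rewrite muln_gt0 expn_gt0 M00 => /(_ isT).
rewrite mulnCA -[(c ^ k * _)%N]mulnC expnMn -!expnM [(k * n)%N]mulnC => H.
by apply: leq_trans H; rewrite leq_pmulr.
Qed.

End Packing.

(** * Bases adapted to a flag of subspaces *)

Section FlagBasis.
Variables (F : fieldType) (vT : vectType F).
Local Open Scope vspace_scope.

(** A basis of [S n] is extended by one of a complement in [S n.+1]. As [S i] may have dimension
    below [i], it is only contained in the span of the first [i] vectors. *)
Lemma flag_basis (S : nat -> {vspace vT}) n :
  (forall i, (i < n)%N -> S i <= S i.+1) ->
  (forall i, (i <= n)%N -> \dim (S i) <= i)%N ->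
  exists f : seq vT, basis_of (S n) f /\
    forall i, (i <= n)%N -> S i <= <<take i f>>.
Proof.
elim: n => [|n IHn] SS dS.
  exists (vbasis (S 0%N)); split; first exact: vbasisP.
  move=> i; rewrite leqn0 => /eqP->.
  by have := dS 0%N (leqnn 0); rewrite leqn0 dimv_eq0 => /eqP->; rewrite sub0v.
have [|i /leqW|f [bf Sf]] := IHn; [|exact: dS|].
  by move=> i /leqW; apply: SS.
have Sn := SS n (leqnn _).
pose g : seq vT := vbasis (S n.+1 :\: S n).
have bg : basis_of (S n.+1 :\: S n) g by exact: vbasisP.
move: g bg => g bg.
have bfg : basis_of (S n.+1) (f ++ g).
  have -> : S n.+1 = S n + (S n.+1 :\: S n).
    by rewrite addvC -[LHS](addv_diff_cap _ (S n)) (capv_idPr Sn).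
  apply: cat_basis => //.
  by apply/directv_addP; rewrite capvC capv_diff.
exists (f ++ g); split=> // i; rewrite leq_eqVlt => /orP[/eqP->|].
  have sfg : size (f ++ g) = \dim (S n.+1).
    by rewrite -(size_basis (X := in_tuple (f ++ g)) bfg).
  by rewrite take_oversize ?sfg ?dS// (span_basis (X := in_tuple (f ++ g)) bfg).
rewrite ltnS => /Sf /subv_trans; apply; apply: sub_span => x xf.
by rewrite take_cat; case: ltnP => // fi; rewrite mem_cat (mem_take xf).
Qed.

Lemma coord_span_take n (f : n.-tuple vT) i (j : 'I_n) v :
  free f -> (i <= j)%N -> v \in <<take i f>> -> coord f j v = 0%R.
Proof.
move=> ff ij.
suff /subvP H : <<take i f>> <= lker (linfun (coord f j : vT -> F^o)).
  by move=> /H; rewrite memv_ker lfunE /= => /eqP.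
apply/span_subvP => x xf.
have /(nthP 0%R)[k] := xf; rewrite size_take_min size_tuple => kn <-.
have {kn} [ki kn] : (k < i)%N /\ (k < n)%N by split; lia.
rewrite memv_ker lfunE /= nth_take// (coord_free (Ordinal kn))//.
have [kj|] := eqVneq (Ordinal kn) j; last by [].
by move: (congr1 val kj) => /= {}kj; lia.
Qed.

End FlagBasis.

(** * From a flag of subspaces to coordinates *)

Section FlagSeparated.
Variables (R : realType) (d : nat) (K : set 'rV[R]_d) (r : R) (B : nat).
Hypothesis cK : convex K.
Hypothesis Kr : forall x : 'rV[R]_d, `|x| <= r -> difference_body K x.
Hypothesis r0 : 0 < r.
Hypothesis KB : forall x, K x -> `|x| <= B%:R.
Variables (A : {fset 'rV[R]_d}) (n : nat) (S : nat -> {vspace 'rV[R]_d}).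
Variables (p : nat -> nat) (q : nat) (kappa : R).
Hypothesis AK : forall a, a \in A -> K a.
Hypothesis SS : forall i, (i < n)%N -> (S i <= S i.+1)%VS.
Hypothesis dS : forall i, (i <= n)%N -> (\dim (S i) <= i)%N.
Hypothesis dSn : \dim (S n) = n.
Hypothesis AS : forall a a', a \in A -> a' \in A -> a' - a \in S n.
Hypothesis kappa0 : 0 < kappa.
Hypothesis q0 : (0 < q)%N.
Hypothesis p0 : p 0%N = 0%N.
Hypothesis pS : forall i, (i < n)%N -> (p i <= p i.+1)%N.
Hypothesis pq : (p n <= q)%N.
Hypothesis Ap : forall a a' i, a \in A -> a' \in A -> (i < n)%N ->
  dilate ((p i.+1).+1%:R / (2 * q)%:R * (1 + kappa)) (difference_body K) (a' - a) ->
  a' - a \in S i.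

(** In coordinates for a basis adapted to the flag, membership in [S i] kills the entries from [i]
    on, which is the separation needed for the packing. *)
Lemma card_flag_separated_le :
  (#|` A| * \prod_(i < n) p i.+1 <= (3 * q).+1 ^ n)%N.
Proof.
have [->|[a0 Aa0]] := fset_0Vmem A; first by rewrite cardfs0.
have [f0 [bf Sf]] := flag_basis SS dS.
have sf : size f0 == n by rewrite -dSn (size_basis (X := in_tuple f0) bf).
pose f : n.-tuple _ := Tuple sf.
have ff : free f := basis_free bf.
pose phi (x : 'rV[R]_n) : 'rV[R]_d := \sum_(i < n) x 0 i *: f`_i.
pose xi (v : 'rV[R]_d) : 'rV[R]_n := \row_i coord f i v.
have phiB x y : phi (x - y) = phi x - phi y.
  by rewrite /phi -sumrB; apply: eq_bigr => i _; rewrite !mxE scalerBl.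
have phiZ t x : phi (t *: x) = t *: phi x.
  by rewrite /phi scaler_sumr; apply: eq_bigr => i _; rewrite !mxE scalerA.
have phiD x y : phi (x + y) = phi x + phi y.
  by rewrite /phi -big_split; apply: eq_bigr => i _; rewrite !mxE scalerDl.
have phiK x : xi (phi x) = x.
  by apply/rowP => i; rewrite mxE /phi coord_sum_free.
have xiB u v : xi (u - v) = xi u - xi v.
  by apply/rowP => i; rewrite !mxE linearB.
have xiK v : v \in S n -> phi (xi v) = v.
  move=> vS; rewrite [RHS](coord_basis (X := f) bf vS).
  by apply: eq_bigr => i _; rewrite mxE.
pose eps := kappa * r / 2.
have eps0 : 0 < eps by rewrite divr_gt0 ?mulr_gt0.
(* The section of [K] itself may have empty interior in [S n], so we take the
   section of a neighbourhood of [K]; [kappa] absorbs the enlargement. *)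
pose K' : set 'rV[R]_n := [set x | exists2 y, K y & `|a0 + phi x - y| <= eps].
have cK' : convex K'.
  move=> x x' s t [y Ky yx] [y' Ky' yx'] s0 t0 st.
  exists (s *: y + t *: y'); first exact: cK.
  have -> : a0 + phi (s *: x + t *: x') - (s *: y + t *: y') =
      s *: (a0 + phi x - y) + t *: (a0 + phi x' - y').
    have {st t0} -> : t = 1 - s by rewrite -st addrAC subrr add0r.
    by rewrite phiD !phiZ; apply/rowP => l; rewrite !mxE; ring.
  apply: le_trans (ler_normD _ _) _; rewrite !normrZ !ger0_norm//.
  rewrite -[leRHS]mul1r -st mulrDl.
  by apply: lerD; apply: ler_wpM2l.
(* A Lipschitz constant of [phi]; the summand 1 keeps it positive. *)
pose F : R := 1 + \sum_(i < n) `|f`_i|.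
have F0 : 0 < F by rewrite ltr_wpDr// sumr_ge0.
have K'r x : `|x| <= eps / F -> K' x.
  move=> xe; exists a0; first exact: AK.
  rewrite addrAC subrr add0r; apply: le_trans (ler_norm_sum _ _ _) _.
  apply: le_trans (_ : \sum_(i < n) `|x| * `|f`_i| <= _).
    by apply: ler_sum => i _; rewrite normrZ ler_wpM2r// ler_entry_norm.
  rewrite -mulr_sumr; apply: le_trans (_ : `|x| * F <= _).
    by rewrite ler_wpM2l// lerDr.
  by rewrite -ler_pdivlMr.
(* Bounds the operator norm of [xi], which makes [K'] bounded. *)
pose C : R := \sum_(i < n) \sum_(k < d) `|coord f i (delta_mx 0 k)|.
have xiC v : `|xi v| <= C * `|v|.
  apply: row_norm_le => [|i]; first by rewrite mulr_ge0// !sumr_ge0// => ? _; rewrite sumr_ge0.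
  rewrite mxE [v in coord f i v]row_sum_delta linear_sum /=.
  apply: le_trans (ler_norm_sum _ _ _) _.
  rewrite mulr_suml (bigD1 i)//= mulr_suml ler_wpDr//.
    by rewrite sumr_ge0// => j _; rewrite mulr_ge0// sumr_ge0.
  apply: ler_sum => k _; rewrite linearZ /= normrM mulrC ler_wpM2l//.
  exact: ler_entry_norm.
pose B' := Num.bound (C * (B%:R + eps + `|a0|)).
have C0 : 0 <= C by rewrite !sumr_ge0// => ? _; rewrite sumr_ge0.
have K'B x : K' x -> `|x| <= B'%:R.
  move=> [y Ky yx]; apply: le_trans (ltW (archi_boundP _)); last first.
    by rewrite mulr_ge0 ?addr_ge0// ltW.
  rewrite -[x]phiK; apply: le_trans (xiC _) _; rewrite ler_wpM2l//.
  have -> : phi x = y + (a0 + phi x - y) - a0 by rewrite addrC [y + _]addrC subrK addKr.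
  apply: le_trans (ler_normB _ _) _; rewrite lerD2r.
  apply: le_trans (ler_normD _ _) _; apply: lerD => //; exact: KB.
(* Differences with [a0] lie in [S n], where [phi] inverts [xi]. *)
pose A' := [fset xi (a - a0) | a in A]%fset.
have xiA a a' : a \in A -> a' \in A -> phi (xi (a' - a0) - xi (a - a0)) = a' - a.
  move=> Aa Aa'; rewrite -xiB opprB addrA subrK xiK//.
  exact: AS.
have -> : #|` A| = #|` A'|.
  rewrite card_in_imfset //= => a a' Aa Aa' E; apply/eqP.
  by rewrite eq_sym -subr_eq0 -(xiA a a')// E subrr /phi big1// => i _; rewrite mxE scale0r.
apply: (@card_separated_le _ _ K' (eps / F) B' cK' K'r _ K'B A' p q) => //.
- by rewrite divr_gt0.
- move=> _ /imfsetP[a /= Aa ->]; exists a; first exact: AK.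
  by rewrite xiK ?AS// [a0 + _]addrC subrK subrr normr0 ltW.
move=> _ _ i /imfsetP[a /= Aa ->] /imfsetP[a' /= Aa' ->] D j ij.
have : a' - a \in S i.
  apply: Ap => //; rewrite -(xiA a a')//; case: D => _ [x [y Ky yx] [x' [y' Ky' yx'] <-]] <-.
  rewrite phiZ phiB; apply: dilateMl.
  have -> : phi x - phi x' = (y - y') + ((a0 + phi x - y) - (a0 + phi x' - y')).
    by apply/rowP => l; rewrite !mxE; ring.
  apply: dilateD => //.
  - exact: convex_difference_body.
  - exact: ltW.
  - by exists (y - y'); [exists y => //; exists y'|rewrite scale1r].
  apply: (dilate_ball (r := r)) => //; apply: le_trans (ler_normB _ _) _.
  by apply: le_trans (lerD yx yx') _; rewrite /eps -splitr.
move=> /(subvP (Sf _ (ltnW (ltn_ord i)))) /(coord_span_take ff ij) E.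
apply/eqP; rewrite eq_sym -subr_eq0 !mxE -linearB /= opprB addrA subrK.
by rewrite E.
Qed.

End FlagSeparated.

(** * Basic properties of the successive minima *)

Lemma lin_spanS (F : fieldType) (V : vectType F) (X Y : set V) :
  X `<=` Y -> (lin_span X <= lin_span Y)%VS.
Proof.
move=> XY; have [_] := lin_spanP X; apply.
by have [sY _] := lin_spanP Y; apply: subset_trans sY.
Qed.

Section SuccessiveMinima.
Variables (R : realType) (d : nat) (K L : set 'rV[R]_d).
Hypotheses (hK : is_convex_body K) (hL : is_lattice L).

Let cK : convex K. Proof. exact: convex_setE (convex_body_convex hK). Qed.

Lemma body_bound : exists B : nat, forall x, K x -> `|x| <= B%:R.
Proof.
have [M M0 KM] := pinfty_ex_gt (real0 R) (convex_body_bounded hK).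
exists (Num.bound M) => x Kx; apply: le_trans (KM _ Kx) _.
exact/ltW/archi_boundP/ltW.
Qed.

Lemma difference_body_ball : exists2 r : R, 0 < r &
  forall x : 'rV[R]_d, `|x| <= r -> difference_body K x.
Proof.
have [u /nbhs_ballP[e /= e0 ue]] := convex_body_interior hK.
(* Halving fits the closed ball into the open one. *)
exists (e / 2); first by rewrite divr_gt0.
move=> x xe; exists (u + x); last exists u; last by rewrite addrC addKr.
  apply: ue; rewrite -ball_normE /ball_/= opprD addNKr normrN.
  by apply: le_lt_trans xe _; rewrite ltr_pdivrMr// mulr_natr mulr2n ltrDl.
by apply: ue; apply: ballxx.
Qed.

Lemma lattice_gap : exists2 r : R, 0 < r & forall x, L x -> `|x| < r -> x = 0.
Proof.
have L0 : L 0 by have [+ _] := lattice_subgroup hL; rewrite inE.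
have [_ [V /nbhs_ballP[e /= e0 Ve] VL]] := lattice_discrete hL L0.
exists e => // x Lx xe.
have : (V `&` L) x by split=> //; apply: Ve; rewrite -ball_normE /ball_/= sub0r normrN.
by rewrite VL.
Qed.

Definition minima_vectors (t : R) : set 'rV[R]_d :=
  dilate (t / 2) (difference_body K) `&` L.

Lemma minima_vectorsS s t : 0 <= s -> s <= t ->
  minima_vectors s `<=` minima_vectors t.
Proof.
move=> s0 st x [Dx Lx]; split=> //.
have [r r0 Kr] := difference_body_ball.
apply: dilateS Dx; first exact: convex_difference_body.
- by apply: Kr; rewrite normr0 ltW.
- by rewrite divr_ge0.
- by rewrite ler_pM2r// invr_gt0.
Qed.

Lemma succ_min_ub i t : 0 < t ->
  (i <= \dim (lin_span (minima_vectors t)))%N -> succ_min K L i <= t.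
Proof. by move=> t0 it; apply: ge_inf => //; exists 0 => s [/ltW]. Qed.

(** Guards against the default value of [inf] on an empty set: a large dilate of K - K contains a
    finite set spanning the same space as [L]. *)
Lemma succ_min_nonempty i : (i <= d)%N ->
  exists2 t : R, 0 < t & (i <= \dim (lin_span (minima_vectors t)))%N.
Proof.
move=> id; have [r r0 Kr] := difference_body_ball.
have [s [sL [Ls _]]] := lin_span_exists L.
have [_ /(_ _ Ls) Lspan] := lin_spanP L.
pose M : R := \sum_(x <- s) `|x|.
have M0 : 0 <= M by rewrite sumr_ge0.
have t0 : 0 < 2 * ((M + 1) / r) by rewrite mulr_gt0 ?divr_gt0// ltr_wpDl.
exists (2 * ((M + 1) / r)) => //.
apply: leq_trans id _.
apply: (@leq_trans (\dim (lin_span L))); first by rewrite (lattice_full_rank hL).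
apply: dimvS.
apply: subv_trans Lspan _; apply/span_subvP => x xs.
have [+ _] := lin_spanP (minima_vectors (2 * ((M + 1) / r))); apply; split; last exact: sL.
rewrite mulrAC divff// mul1r; apply: (dilate_ball _ Kr).
  by rewrite divr_gt0// ltr_wpDl.
rewrite divfK ?gt_eqF// /M (big_rem x xs)/= -addrA lerDl addr_ge0//.
by rewrite sumr_ge0.
Qed.

Lemma succ_min_le i j : (i <= j)%N -> (j <= d)%N ->
  succ_min K L i <= succ_min K L j.
Proof.
move=> ij jd; apply: lb_le_inf.
  by have [t t0 tj] := succ_min_nonempty jd; exists t.
by move=> t [t0 tj]; apply: succ_min_ub t0 (leq_trans ij tj).
Qed.

(** For t < r/(B + 1) the points of (t/2)(K - K) have norm at most tB < r, so the only possible
    lattice point is 0. *)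
Lemma succ_min_gt0 i : (0 < i)%N -> (i <= d)%N -> 0 < succ_min K L i.
Proof.
move=> i0 id; have [B KB] := body_bound; have [r r0 Lr] := lattice_gap.
have Br : 0 < r / B.+1%:R by rewrite divr_gt0// ltr0n.
apply: lt_le_trans Br _; apply: lb_le_inf.
  by have [t t0 tj] := succ_min_nonempty id; exists t.
move=> t [t0 ti]; rewrite leNgt; apply/negP => tr.
suff : (lin_span (minima_vectors t) <= 0)%VS.
  rewrite subv0 => /eqP E; move: ti; rewrite -/(minima_vectors t) E dimv0 leqNgt.
  by rewrite i0.
have [_] := lin_spanP (minima_vectors t); apply=> x [[_ [a Ka [b Kb <-]] <-] Lx].
rewrite /= memv0; apply/eqP/Lr => //.
rewrite normrZ gtr0_norm ?divr_gt0//.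
have ab : `|a - b| <= 2 * B%:R.
  by rewrite mulr_natl mulr2n; apply: le_trans (ler_normB _ _) _; apply: lerD; apply: KB.
apply: le_lt_trans (_ : t / 2 * (2 * B%:R) < _).
  by rewrite ler_wpM2l// divr_ge0// ltW.
rewrite mulrA divfK ?pnatr_eq0//; move: tr; rewrite ltr_pdivlMr ?ltr0n//.
by apply: le_lt_trans; rewrite ler_wpM2l ?(ltW t0)// ler_nat.
Qed.

Lemma dim_minima_vectors i t : 0 < t -> t < succ_min K L i ->
  (\dim (lin_span (minima_vectors t)) < i)%N.
Proof.
by move=> t0 ti; rewrite ltnNge; apply/negP => /(succ_min_ub t0); rewrite leNgt ti.
Qed.

End SuccessiveMinima.

(** Both sides are polynomials in [e], so the inequality survives the limit e -> 0+. *)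
Lemma le_of_perturbed (R : realType) (a b : R) (k l : nat) :
  (forall e, 0 < e -> e < 1 -> a * (1 - e) ^+ k <= b * (1 + e) ^+ l) -> a <= b.
Proof.
move=> H; pose P : {poly R} := a%:P * (1 - 'X) ^+ k.
pose Q : {poly R} := b%:P * (1 + 'X) ^+ l.
have PE e : P.[e] = a * (1 - e) ^+ k by rewrite /P !hornerE.
have QE e : Q.[e] = b * (1 + e) ^+ l by rewrite /Q !hornerE.
have -> : a = P.[0] by rewrite PE subr0 expr1n mulr1.
have -> : b = Q.[0] by rewrite QE addr0 expr1n mulr1.
apply: (@ler_cvg_to _ (0^'+) _ _ (horner P) (horner Q)).
- exact/cvg_at_right_filter/continuous_horner.
- exact/cvg_at_right_filter/continuous_horner.
near=> e; rewrite PE QE; apply: H; near: e; last exact: nbhs_right_lt.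
exact: nbhs_right_gt.
Unshelve. all: by end_near. Qed.

(** * Bounding a finite set of lattice points of the body *)

Section Counting.
Variables (R : realType) (d : nat) (K L : set 'rV[R]_d).
Hypotheses (hK : is_convex_body K) (hL : is_lattice L).
Variables (A : {fset 'rV[R]_d}) (a0 : 'rV[R]_d).
Hypothesis AK : forall a, a \in A -> K a.
Hypothesis AL : forall a, a \in A -> L a.
Hypothesis Aa0 : a0 \in A.

(** The direction space of the affine hull of [A]. *)
Let W : {vspace 'rV[R]_d} := <<[seq a - a0 | a <- A]>>%VS.
Let n := \dim W.
Let lambda := succ_min K L.
(** The cap at 1 ensures [p n <= q] in the packing. *)
Let mu i := Num.min 1 (lambda i).

Let mem_W a a' : a \in A -> a' \in A -> a' - a \in W.
Proof.
move=> Aa Aa'; have -> : a' - a = (a' - a0) - (a - a0) by rewrite opprB addrA subrK.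
by apply: memvB; apply: memv_span; apply/mapP; [exists a'|exists a].
Qed.

Let LB a a' : a \in A -> a' \in A -> L (a' - a).
Proof.
move=> Aa Aa'; have [_ subL] := lattice_subgroup hL.
by have := subL a' a; rewrite !inE; apply; apply: AL.
Qed.

Lemma dim_differences_le_d : (n <= d)%N.
Proof. by have := dimvS (subvf W); rewrite dimvf /dim /= mul1n. Qed.

(** Differences of points of [A] lie in K - K, the dilate (2/2)(K - K); this is the source of
    lambda_n <= 2 and n <= m. *)
Lemma dim_differences_le : (n <= \dim (lin_span (minima_vectors K L 2)))%N.
Proof.
apply: dimvS; apply/span_subvP => _ /mapP[a Aa ->].
have [+ _] := lin_spanP (minima_vectors K L 2); apply; split; last exact: LB.
rewrite divff ?pnatr_eq0//; exists (a - a0); last by rewrite scale1r.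
by exists a; [exact: AK|exists a0 => //; exact: AK].
Qed.

Lemma mu_gt0 i : (0 < i)%N -> (i <= d)%N -> 0 < mu i.
Proof. by move=> i0 id; rewrite lt_min ltr01 succ_min_gt0. Qed.

Lemma mu_le i j : (i <= j)%N -> (j <= d)%N -> mu i <= mu j.
Proof.
move=> ij jd; rewrite le_min ge_min lexx ge_min (succ_min_le hK hL ij jd) orbT.
by [].
Qed.

Lemma mu_le1 i : mu i <= 1. Proof. by rewrite ge_min lexx. Qed.

(** Of the three factors 1 - e per coordinate, two keep the vectors shorter than lambda_i despite
    the enlargement by kappa = e, and one pays for rounding to integers. The factor 1 + e pays for
    the 1 in 3q + 1. *)
Lemma card_perturbed_le e : 0 < e -> e < 1 ->
  #|` A|%:R * \prod_(i < n) mu i.+1 * (1 - e) ^+ (3 * n) <=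
  3 ^+ n * (1 + e) ^+ n.
Proof.
move=> e0 e1.
have cK := convex_setE (convex_body_convex hK).
have [B KB] := body_bound hK; have [r r0 Kr] := difference_body_ball hK.
have nd := dim_differences_le_d.
have e'0 : 0 < 1 - e by rewrite subr_gt0.
(* If [n] is 0, [A] is a single point and the claim reads 1 <= 1; otherwise [mu 1] is positive and
   can be used to choose [q]. *)
have [n0|n0] := posnP n.
  have -> : #|` A| = 1%N.
    suff -> : A = [fset a0]%fset by rewrite cardfs1.
    apply/fsetP => a; rewrite inE; apply/idP/eqP => [Aa|->//].
    have := mem_W Aa0 Aa; rewrite /W.
    have /eqP : W == 0%VS by rewrite -dimv_eq0 -/n n0.
    by rewrite /W => ->; rewrite memv0 subr_eq0 => /eqP.
  by rewrite n0 big_ord0 muln0 !expr0 !mulr1.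
pose s : R := (1 - e) ^+ 2.
have s0 : 0 < s by rewrite exprn_gt0.
have s1 : s * (1 + e) <= 1 - e.
  have : 0 <= (1 - e) * e ^+ 2 by rewrite mulr_ge0 ?exprn_ge0// ltW.
  rewrite /s; nra.
have m1 : 0 < mu 1 by apply: mu_gt0 => //; apply: leq_trans nd.
(* The first term gives q e s mu_i >= 2, the cost of truncation and predecessor in [p]; the second
   gives q e >= 1. *)
pose X := 2 / (e * s * mu 1) + 1 / e.
have X0 : 0 <= X by rewrite addr_ge0// divr_ge0// ?mulr_ge0// ltW.
have [q Xq] : exists q : nat, X < q%:R by exists (Num.bound X); apply: archi_boundP.
have q0 : 0 < q%:R :> R by apply: le_lt_trans Xq.
have eq1 : 1 <= q%:R * e.
  rewrite -ler_pdivrMr//; apply: le_trans (ltW Xq).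
  by rewrite lerDr divr_ge0// ?mulr_ge0// ltW.
have eq2 : 2 <= q%:R * (e * s * mu 1).
  rewrite -ler_pdivrMr ?mulr_gt0//; apply: le_trans (ltW Xq).
  by rewrite lerDl divr_ge0// ltW.
(* The predecessor compensates the successor in the separation hypothesis. *)
pose p i := if i is j.+1 then (Num.truncn (q%:R * s * mu j.+1)).-1 else 0%N.
have qsm i : (i < n)%N -> 2 <= q%:R * s * mu i.+1 * e.
  move=> i_n; apply: le_trans eq2 _.
  have -> : q%:R * (e * s * mu 1) = q%:R * s * mu 1 * e by ring.
  rewrite ler_pM2r// ler_pM2l ?mulr_gt0//.
  by apply: mu_le => //; apply: leq_trans nd.
have qsm0 i : (i < n)%N -> 0 <= q%:R * s * mu i.+1.
  move=> i_n; rewrite !mulr_ge0 ?ltW// ?mu_gt0//; exact: leq_trans nd.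
have qsm1 i : (i < n)%N -> 2 <= q%:R * s * mu i.+1.
  move=> i_n; apply: le_trans (qsm _ i_n) _.
  by rewrite ler_piMr ?qsm0// ltW.
have pE i : (i < n)%N -> (p i.+1).+1 = Num.truncn (q%:R * s * mu i.+1).
  move=> i_n; rewrite /p prednK// truncn_gt0.
  by apply: le_trans (qsm1 _ i_n); rewrite ler1n.
have p_le i : (i < n)%N -> (p i.+1).+1%:R <= q%:R * s * mu i.+1.
  by move=> i_n; rewrite pE// truncn_le qsm0.
have p_ge i : (i < n)%N -> q%:R * ((1 - e) ^+ 3 * mu i.+1) <= (p i.+1)%:R.
  move=> i_n; have := truncnS_gt (q%:R * s * mu i.+1); rewrite -pE//.
  have := qsm i i_n; rewrite -!natr1 /s; nra.
pose tau i := (1 - e) * mu i.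
(* As [tau i.+1] is below lambda_(i+1), the short vectors span dimension at most [i]; [W] closes the
   flag with dimension exactly [n]. *)
pose S i := if (i < n)%N then (lin_span (minima_vectors K L (tau i.+1)) :&: W)%VS
            else W.
have tau0 i : (i < n)%N -> 0 < tau i.+1.
  move=> i_n; rewrite mulr_gt0 ?mu_gt0//; exact: leq_trans nd.
have H : (#|` A| * \prod_(i < n) p i.+1 <= (3 * q).+1 ^ n)%N.
  apply: (@card_flag_separated_le _ _ K r B cK Kr r0 KB A n S p q e) => //.
  - move=> i i_n; rewrite /S i_n; case: ltnP => [i_n'|_]; last exact: capvSr.
    apply: capvS => //; apply: lin_spanS; apply: minima_vectorsS => //.
      by rewrite ltW ?tau0.
    rewrite ler_pM2l//; apply: mu_le => //; exact: leq_trans i_n' nd.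
  - move=> i; rewrite leq_eqVlt => /orP[/eqP->|i_n]; rewrite /S ?ltnn// i_n.
    apply: leq_trans (dimvS (capvSl _ _)) _.
    rewrite -ltnS; apply: dim_minima_vectors; first exact: tau0.
    apply: lt_le_trans (_ : mu i.+1 <= _); last by rewrite ge_min lexx orbT.
    rewrite gtr_pMl ?mu_gt0//; [lra|exact: leq_trans nd].
  - by rewrite /S ltnn.
  - by move=> a a' Aa Aa'; rewrite /S ltnn mem_W.
  - by rewrite -(ltr_nat R).
  - case=> [|i] i_n//=; rewrite -!subn1 leq_sub2r// le_truncn//.
    rewrite ler_pM2l ?mulr_gt0//; apply: mu_le => //; exact: leq_trans nd.
  - have -> : n = n.-1.+1 by rewrite prednK.
    have n1 : (n.-1 < n)%N by rewrite prednK.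
    rewrite -(ler_nat R); apply: le_trans (_ : (p n.-1.+1).+1%:R <= _); first by rewrite ler_nat.
    apply: le_trans (p_le _ n1) _; rewrite -mulrA ler_piMr ?ler0n//.
    apply: mulr_ile1; [exact: ltW| |by rewrite exprn_ile1 ?ltW//; lra|exact: mu_le1].
    by rewrite ltW// mu_gt0// prednK.
  move=> a a' i Aa Aa' i_n D; rewrite /S i_n memv_cap mem_W// andbT.
  have [+ _] := lin_spanP (minima_vectors K L (tau i.+1)); apply; split; last exact: LB.
  apply: dilateS D; first exact: convex_difference_body.
  - by apply: Kr; rewrite normr0 ltW.
  - by rewrite mulr_ge0 ?divr_ge0 ?ler0n// addr_ge0 ?ltW.
  rewrite natrM; apply: le_trans (_ : (q%:R * s * mu i.+1) / (2 * q%:R) * (1 + e) <= _).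
    rewrite ler_pM2r ?addr_gt0// ler_pM2r ?invr_gt0 ?mulr_gt0//; exact: p_le.
  have -> : q%:R * s * mu i.+1 / (2 * q%:R) * (1 + e) = s * (1 + e) * mu i.+1 / 2.
    by field; rewrite gt_eqF.
  rewrite ler_pM2r ?invr_gt0// ler_pM2r//; apply: mu_gt0 => //; exact: leq_trans nd.
have q0n : 0 < q%:R ^+ n :> R by rewrite exprn_gt0.
rewrite -(ler_pM2l q0n).
have {}H : #|` A|%:R * \prod_(i < n) (p i.+1)%:R <= ((3 * q).+1 ^ n)%:R :> R.
  by rewrite -natr_prod -natrM ler_nat.
apply: (le_trans (_ : _ <= #|` A|%:R * \prod_(i < n) (p i.+1)%:R)).
  rewrite [X in X <= _](_ : _ = #|` A|%:R * \prod_(i < n) (q%:R * ((1 - e) ^+ 3 * mu i.+1))).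
    apply: ler_wpM2l => //; apply: ler_prod => i _; rewrite p_ge// andbT.
    rewrite !mulr_ge0 ?exprn_ge0 ?ltW// ?mu_gt0//; exact: leq_trans nd.
  rewrite big_split /= prodr_const big_split /= prodr_const card_ord exprM.
  by rewrite mulrCA -mulrA; congr (_ * _); rewrite mulrC -mulrA.
apply: le_trans H _; rewrite natrX -!exprMn; apply: lerXn2r.
- by rewrite nnegrE.
- by rewrite nnegrE !mulr_ge0 ?addr_ge0 ?ltW.
rewrite -natr1 natrM mulrCA mulrDr mulr1 [leRHS]mulrDr lerD2l.
by apply: le_trans eq1 _; rewrite ler_peMl ?ler1n// mulr_ge0// ltW.
Qed.

Lemma card_mu_le : #|` A|%:R * \prod_(i < n) mu i.+1 <= 3 ^+ n.
Proof. exact/le_of_perturbed/card_perturbed_le. Qed.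

(** Since mu_j = lambda_j for j <= k and mu_j = 1 for k < j <= d, the product of the first [k]
    minima is that of all the mu_j, hence at most that of the first [n], because mu_j <= 1. *)
Lemma card_points_le k m :
  k = (\max_(1 <= j < d.+1 | (lambda j <= 1)%R) j)%N ->
  m = (\max_(1 <= j < d.+1 | (lambda j <= 2)%R) j)%N ->
  #|` A|%:R * \prod_(1 <= j < k.+1) lambda j <= 3 ^+ m.
Proof.
move=> kE mE; have nd := dim_differences_le_d.
have max_ub c j : (0 < j)%N -> (j <= d)%N -> lambda j <= c ->
    (j <= \max_(1 <= j < d.+1 | (lambda j <= c)%R) j)%N.
  move=> j0 jd jc; apply: (@leq_bigmax_seq _ _ _ id j) => //.
  by rewrite mem_index_iota j0 ltnS.
(* The maximum over an empty family is 0; otherwise it is attained. *)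
have kP : k = 0%N \/ (k <= d)%N /\ lambda k <= 1.
  rewrite kE big_nat_cond; elim/big_ind : _ => [|x y hx hy|j]; first by left.
    by rewrite /maxn; case: ifP.
  by move=> /andP[/andP[j0 jd] jl]; right.
have kd : (k <= d)%N by case: kP => [->|[]].
have lam_mu j : (j < k)%N -> lambda j.+1 = mu j.+1.
  case: kP => [->//|[_ lk] jk]; apply/esym/min_idPr.
  exact: le_trans (succ_min_le hK hL jk kd) lk.
have mu1 j : (k <= j)%N -> (j < d)%N -> mu j.+1 = 1.
  move=> kj jd; apply/min_idPl; rewrite leNgt; apply/negP => /ltW jl.
  by have := max_ub 1 j.+1 isT jd jl; rewrite -kE ltnNge kj.
have nm : (n <= m)%N.
  have [->//|n0] := posnP n; rewrite mE; apply: max_ub => //.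
  exact: succ_min_ub (dim_differences_le).
apply: le_trans (_ : #|` A|%:R * \prod_(i < n) mu i.+1 <= _); last first.
  apply: le_trans card_mu_le _; rewrite ler_weXn2l//; lra.
apply: ler_wpM2l => //; rewrite big_add1 /= big_mkord.
rewrite (eq_bigr (fun i : 'I_k => mu i.+1)) => [|i _]; last exact: lam_mu.
have mu_ge0 j : (j < d)%N -> 0 <= mu j.+1 by move=> jd; rewrite ltW ?mu_gt0.
rewrite (big_ord_widen d (fun i => mu i.+1))// (big_ord_widen d (fun i => mu i.+1) nd).
rewrite [leLHS]big_mkcond [leRHS]big_mkcond /=.
apply: ler_prod => i _; have id := ltn_ord i.
case: (ltnP i k) => ik; case: (ltnP i n) => i_n; rewrite ?ler01 ?mu_ge0 ?mu_le1 ?lexx//.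
by rewrite mu1 ?lexx ?ler01.
Qed.

End Counting.

(** * From finite subsets to all lattice points of the body *)

Theorem corollary1p4 (R : realType) (d : nat) (K L : set 'rV[R]_d)
    (hK : is_convex_body K) (hL : is_lattice L)
    (hex : exists2 i : nat, (1 <= i <= d)%N & 1 < succ_min K L i <= 2) :
  let lambda := succ_min K L in
  let k := (\max_(1 <= j < d.+1 | (lambda j <= 1)%R) j)%N in
  let m := (\max_(1 <= j < d.+1 | (lambda j <= 2)%R) j)%N in
  finite_set (K `&` L) /\
  #|` fset_set (K `&` L)|%:R <= 3 ^+ m / \prod_(1 <= j < k.+1) lambda j.
Proof.
move=> lambda k m.
have kd : (k <= d)%N.
  rewrite /k big_nat_cond; elim/big_ind : _ => // [x y xd yd|j].
    by rewrite geq_max xd.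
  by move=> /andP[/andP[_ ]].
have P0 : 0 < \prod_(1 <= j < k.+1) lambda j.
  rewrite big_nat_cond; apply: prodr_gt0 => j /andP[/andP[j0 jk] _].
  by apply: succ_min_gt0 => //; apply: leq_trans kd.
set b := 3 ^+ m / _; have b0 : 0 <= b by rewrite divr_ge0// ltW.
have bound (A : {fset 'rV[R]_d}) : [set` A] `<=` K `&` L -> #|` A|%:R <= b.
  move=> AKL; have [->|[a0 Aa0]] := fset_0Vmem A; first by rewrite cardfs0.
  rewrite ler_pdivlMr//; apply: (card_points_le hK hL _ _ Aa0) => // a Aa.
    by case: (AKL a Aa).
  by case: (AKL a Aa).
(* An infinite set would contain finite subsets with more than [b] points. *)
have fin : finite_set (K `&` L).
  apply: contrapT => inf.
  have [A AKL cA] := infinite_set_fset (Num.bound b) inf.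
  have := le_lt_trans (bound A AKL) (archi_boundP b0).
  by rewrite ltr_nat ltnNge cA.
by split=> //; apply: bound; rewrite fset_setK.
Qed.
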